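(* For a topological group $G$, the following are equivalent. (i) $G$ has the fixed point on compacta property. (ii) The pair $(G,G_L)$, where $G_L$ is $G$ with its left uniform structure and $G$ acts on it by left translations, has the Ramsey--Dvoretzky--Milman property. (iii) For every left-invariant continuous pseudometric $d$ on $G$, the pair $(G,G/d)$ has the Ramsey--Dvoretzky--Milman property. (iv) Whenever $G$ acts continuously and transitively by isometries on a metric space $X$, the pair $(G,X)$ has the Ramsey--Dvoretzky--Milman property. (v) For some family $D$ of bounded continuous left-invariant pseudometrics $d$, generating the topology of $G$, each pair $(G,G/d)$, $d\in D$, has the Ramsey--Dvoretzky--Milman property.
   Context: A topological group has the fixed point on compacta property (is extremely amenable) if it has a fixed point in every compact space on which it acts continuously. Ramsey--Dvoretzky--Milman property: let $G$ be a group acting on a uniform space $X$ by uniform isomorphisms. The pair $(G,X)$ has the Ramsey--Dvoretzky--Milman property if for every bounded uniformly continuous function $f$ from $X$ to a finite-dimensional Euclidean space, every $\varepsilon>0$, and every compact $K\subseteq X$, the function $f$ is $\varepsilon$-constant on a suitable translate of $K$, that is, there is $g\in G$ such that the oscillation of $f$ on $gK$ is less than $\varepsilon$: $\mathrm{Osc}(f\mid gK)<\varepsilon$. Equivalently, ''compact'' can be replaced with ''finite''. Metric spaces carry their metric uniformity. The left uniform structure of $G$ has as basic entourages the sets $V_L=\{(g,h)\in G\times G : g^{-1}h\in V\}$, with $V$ a neighbourhood of the identity. For a left-invariant continuous pseudometric $d$ on $G$, put $H_d=\{x\in G : d(x,e_G)=0\}$, where $e_G$ is the identity of $G$; this is a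 closed subgroup. $G/d$ denotes the left $G$-space $G/H_d$ equipped with the left-invariant metric $\hat d(xH_d,yH_d)=d(x,y)$, i.e. the metric space canonically associated with the pseudometric space $(G,d)$, with $G$ acting by left translations.
   Formalization: In (v), ''generating the topology'' is taken to mean that the open balls of single members of D form a base (as for a directed family); with a mere subbase the equivalence fails, e.g. for the permutation group of the natural numbers with d_k(g,h)=1 if g(k)≠h(k), else 0. *)

(* Defs.v *)
From HB Require Import structures.
From mathcomp Require Import all_boot all_order all_algebra.
From mathcomp Require Import all_classical all_reals all_analysis.

Set Implicit Arguments.
Unset Strict Implicit.
Unset Printing Implicit Defensive.

Import Order.TTheory GRing.Theory Num.Theory.
Import numFieldNormedType.Exports.

Local Open Scope classical_set_scope.
Local Open Scope ring_scope.
Local Open Scope quotient_scope.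

(* No separation axiom is imposed. *)
HB.mixin Record Topological_isTopologicalGroup G & Topological G & Group G := {
  mulg_continuous : continuous (fun p : G * G => (p.1 * p.2)%g) ;
  invg_continuous : continuous (fun x : G => (x^-1)%g)
}.

#[short(type="topologicalGroupType")]
HB.structure Definition TopologicalGroup :=
  {G of Topological G & Group G & Topological_isTopologicalGroup G}.

(* [action] in MathComp is restricted to finite acting groups. *)
Definition is_left_action (G : groupType) (X : Type) (act : G -> X -> X) :=
  (forall x, act 1%g x = x) /\
  (forall g h x, act (g * h)%g x = act g (act h x)).

Definition continuous_action (G : topologicalGroupType) (X : topologicalType)
    (act : G -> X -> X) :=
  is_left_action act /\ continuous (fun p : G * X => act p.1 p.2).

Definition transitive_action (G : groupType) (X : Type) (act : G -> X -> X) :=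
  forall x y, exists g, act g x = y.

Definition acts_by_isometries (R : realType) (G : groupType) (X : metricType R)
    (act : G -> X -> X) :=
  forall g x y, mdist (act g x) (act g y) = mdist x y.

Definition acts_by_uniform_isomorphisms (G : groupType) (X : uniformType)
    (act : G -> X -> X) :=
  is_left_action act /\ forall g, unif_continuous (act g).

Lemma isometries_uniform (R : realType) (G : groupType) (X : metricType R)
    (act : G -> X -> X) :
  is_left_action act -> acts_by_isometries act ->
  acts_by_uniform_isomorphisms act.
Proof.
move=> actG isoG; split=> // g A.
rewrite /nbhs /= -!entourage_ballE => -[e e0 sA]; exists e => //= -[x y] /=.
rewrite ballEmdist /= => xy; apply: sA => /=.
by rewrite ballEmdist /= isoG.
Qed.

(* Compacta are nonempty and Hausdorff. *)
Definition fixed_point_on_compacta (G : topologicalGroupType) :=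
  forall (X : topologicalType) (act : G -> X -> X),
    [set: X] !=set0 -> compact [set: X] -> hausdorff_space X ->
    continuous_action act ->
    exists x, forall g, act g x = x.

(* The library norm on 'rV[R]_n is the sup norm, whence the explicit Euclidean
   one; both induce the same uniformity, so that [unif_continuous] can be used
   as it stands for maps into 'rV[R]_n. *)
Definition euclidean_norm (R : realType) (n : nat) (u : 'rV[R]_n) : R :=
  Num.sqrt (\sum_(i < n) u ord0 i ^+ 2).

Definition oscillation (R : realType) (X : Type) (n : nat) (f : X -> 'rV[R]_n)
    (A : set X) : \bar R :=
  ereal_sup [set (euclidean_norm (f p.1 - f p.2))%:E | p in A `*` A].

(* Meaningful when [acts_by_uniform_isomorphisms act]. *)
Definition RDM_property (R : realType) (G : groupType) (X : uniformType)
    (act : G -> X -> X) :=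
  forall (n : nat) (f : X -> 'rV[R]_n),
    (exists M : R, forall x, euclidean_norm (f x) <= M) ->
    unif_continuous f ->
    forall (e : R) (K : set X), 0 < e -> compact K ->
    exists g : G, (oscillation f (act g @` K) < e%:E)%E.

Definition left_uniform (G : topologicalGroupType) : Type := G.

Section LeftUniform.
Variable G : topologicalGroupType.

HB.instance Definition _ := Topological.on (left_uniform G).

Definition left_entourage : set_system (left_uniform G * left_uniform G) :=
  filter_from (nbhs (1%g : G))
    (fun V : set G => [set p : G * G | V (p.1^-1 * p.2)%g]).

Let left_entourage_filter : Filter left_entourage.
Proof.
apply: filter_from_filter; first by exists setT; exact: filterT.
by move=> A B nA nB; exists (A `&` B); first exact: filterI.
Qed.

Let left_entourage_diagonal A : left_entourage A -> diagonal `<=` A.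
Proof.
move=> [V nV sVA] [x y] /diagonalP <-; apply: sVA => /=.
by rewrite mulVg; exact: nbhs_singleton.
Qed.

Let left_entourage_inv A : left_entourage A -> left_entourage A^-1%relation.
Proof.
move=> [V nV sVA]; exists ((fun x : G => x^-1)%g @^-1` V).
  have := @invg_continuous G 1%g; rewrite /continuous_at invg1; exact.
by move=> [x y] /= Vxy; apply: sVA => /=; rewrite invgM invgK in Vxy.
Qed.

Let left_entourage_split A : left_entourage A ->
  exists2 B, left_entourage B & (B \; B `<=` A)%relation.
Proof.
move=> [V nV sVA].
have /= := @mulg_continuous G (1%g, 1%g); rewrite /continuous_at /= mulg1.
move=> /(_ V nV) [[P Q] /= [nP nQ] PQV].
exists [set p : left_uniform G * left_uniform G |
  (P `&` Q) ((p.1 : G)^-1 * p.2)%g].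
  by exists (P `&` Q) => //; exact: filterI.
move=> [x z] /= [y [/= Pxy _] [/= _ Qyz]]; apply: sVA => /=.
have := PQV (((x : G)^-1 * y)%g, ((y : G)^-1 * z)%g) (conj Pxy Qyz).
by rewrite /= mulgA mulgK.
Qed.

Let translate_continuous (g : G) : continuous (fun x : G => (g * x)%g).
Proof.
move=> x; apply: (@continuous_comp G (G * G)%type G (fun x => (g, x))
  (fun p => (p.1 * p.2)%g)).
  by apply: cvg_pair => /=; [exact: cvg_cst|exact: cvg_id].
exact: mulg_continuous.
Qed.

Let left_nbhsE : @nbhs _ (left_uniform G) = nbhs_ left_entourage.
Proof.
apply/funext => x; apply/seteqP; split=> U.
  move=> nU; exists [set p : left_uniform G * left_uniform G |
      [set y : G | U ((x : G) * y)%g] ((p.1 : G)^-1 * p.2)%g].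
    exists [set y : G | U ((x : G) * y)%g] => //.
    have := @translate_continuous x 1%g; rewrite /continuous_at mulg1; exact.
  by move=> y /xsectionP /=; rewrite mulVKg.
move=> [A [V nV sVA] sAU].
have : nbhs (x : G) [set y : G | V ((x : G)^-1 * y)%g].
  have := @translate_continuous (x^-1)%g x.
  by rewrite /continuous_at mulVg; exact.
by apply: filterS => y /= Vy; apply/sAU/xsectionP/sVA.
Qed.

HB.instance Definition _ := Nbhs_isUniform_mixin.Build (left_uniform G)
  left_entourage_filter left_entourage_diagonal left_entourage_inv
  left_entourage_split left_nbhsE.

Definition left_translation (g : G) (x : left_uniform G) : left_uniform G :=
  (g * (x : G))%g.

Lemma left_translation_uniform : acts_by_uniform_isomorphisms left_translation.
Proof.
split; first by split=> [x|g h x]; rewrite /left_translation ?mul1g ?mulgA.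
move=> g A [V nV sVA]; exists V => //= -[x y] /= Vxy; apply: sVA => /=.
by rewrite /left_translation invgM mulgA mulgVK.
Qed.

End LeftUniform.

Record left_invariant_pseudometric (R : realType) (G : topologicalGroupType) :=
  LeftInvariantPseudometric {
    pseudodist :> G -> G -> R ;
    pseudodist_ge0 : forall x y, 0 <= pseudodist x y ;
    pseudodistxx : forall x, pseudodist x x = 0 ;
    pseudodist_sym : forall x y, pseudodist x y = pseudodist y x ;
    pseudodist_triangle : forall y x z,
      pseudodist x z <= pseudodist x y + pseudodist y z ;
    pseudodist_invariant : forall g x y,
      pseudodist (g * x)%g (g * y)%g = pseudodist x y ;
    pseudodist_continuous : continuous (fun p : G * G => pseudodist p.1 p.2)
  }.

Definition bounded_pseudometric (R : realType) (G : topologicalGroupType)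
    (d : left_invariant_pseudometric R G) :=
  exists M : R, forall x y, d x y <= M.

(* The balls of the members of D form a base, not merely a subbase, of the
   topology. A subbase would not do: the pseudometrics
   (g, h) |-> [g k != h k], k : nat, on the group S of permutations of nat form
   a subbase for pointwise convergence, each quotient is nat with the discrete
   metric and has the Ramsey--Dvoretzky--Milman property by the pigeonhole
   principle, yet S is not extremely amenable. *)
Definition generates_topology (R : realType) (G : topologicalGroupType)
    (D : set (left_invariant_pseudometric R G)) :=
  forall (x : G) (U : set G), nbhs x U <->
    exists d : left_invariant_pseudometric R G, exists e : R,
      [/\ D d, 0 < e & [set y | d x y < e] `<=` U].

Section PseudometricQuotient.
Variables (R : realType) (G : topologicalGroupType).
Variable d : left_invariant_pseudometric R G.

Definition zero_subgroup : set G := [set x | d x 1%g = 0].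

Definition same_left_coset : rel G :=
  fun x y => `[< zero_subgroup (x^-1 * y)%g >].

Lemma same_left_cosetE x y : same_left_coset x y = (d x y == 0).
Proof.
have xyE : d (x^-1 * y)%g 1%g = d x y.
  by rewrite -(pseudodist_invariant d x) mulVKg mulg1 pseudodist_sym.
by apply/asboolP/eqP; rewrite /zero_subgroup /= xyE.
Qed.

Let same_left_coset_refl : reflexive same_left_coset.
Proof. by move=> x; rewrite same_left_cosetE pseudodistxx. Qed.

Let same_left_coset_sym : symmetric same_left_coset.
Proof. by move=> x y; rewrite !same_left_cosetE pseudodist_sym. Qed.

Let same_left_coset_trans : transitive same_left_coset.
Proof.
move=> y x z; rewrite !same_left_cosetE => /eqP xy /eqP yz.
rewrite eq_le pseudodist_ge0 andbT.
by have := pseudodist_triangle d y x z; rewrite xy yz addr0.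
Qed.

Canonical same_left_coset_equiv := EquivRel same_left_coset
  same_left_coset_refl same_left_coset_sym same_left_coset_trans.

Definition pseudometric_quotient : Type := {eq_quot same_left_coset}.

HB.instance Definition _ := Choice.on pseudometric_quotient.
HB.instance Definition _ := Quotient.on pseudometric_quotient.

Definition left_coset (x : G) : pseudometric_quotient :=
  \pi_pseudometric_quotient x.

Lemma left_cosetK (a : pseudometric_quotient) : left_coset (repr a) = a.
Proof. exact: reprK. Qed.

Definition quotient_dist (a b : pseudometric_quotient) : R :=
  d (repr a) (repr b).

Let d_repr (x : G) : d (repr (left_coset x)) x = 0.
Proof.
by apply/eqP; rewrite -same_left_cosetE -eqmodE; apply/eqP/left_cosetK.
Qed.

Lemma quotient_distE (x y : G) :
  quotient_dist (left_coset x) (left_coset y) = d x y.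
Proof.
rewrite /quotient_dist; set x' := repr _; set y' := repr _.
have x'x : d x' x = 0 by exact: d_repr.
have y'y : d y' y = 0 by exact: d_repr.
apply/eqP; rewrite eq_le; apply/andP; split.
  rewrite (le_trans (pseudodist_triangle d x _ _))// x'x add0r.
  by rewrite (le_trans (pseudodist_triangle d y _ _))// (pseudodist_sym d y)
    y'y addr0.
rewrite (le_trans (pseudodist_triangle d x' _ _))// (pseudodist_sym d x) x'x.
by rewrite add0r (le_trans (pseudodist_triangle d y' _ _))// y'y addr0.
Qed.

Let quotient_distxx a : quotient_dist a a = 0.
Proof. exact: pseudodistxx. Qed.

Let quotient_dist_positivity a b : quotient_dist a b = 0 -> a = b.
Proof.
move=> /eqP; rewrite -same_left_cosetE => ab.
by rewrite -[a]reprK -[b]reprK; apply/eqP; rewrite eqmodE.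
Qed.

Let quotient_dist_sym a b : quotient_dist a b = quotient_dist b a.
Proof. exact: pseudodist_sym. Qed.

Let quotient_dist_triangle b a c :
  quotient_dist a c <= quotient_dist a b + quotient_dist b c.
Proof. exact: pseudodist_triangle. Qed.

HB.instance Definition _ := isMetric.Build R pseudometric_quotient
  quotient_distxx quotient_dist_positivity quotient_dist_sym
  quotient_dist_triangle.

Definition quotient_translation (g : G) (a : pseudometric_quotient) :
    pseudometric_quotient := left_coset (g * repr a)%g.

Lemma quotient_translationE (g x : G) :
  quotient_translation g (left_coset x) = left_coset (g * x)%g.
Proof.
apply: quotient_dist_positivity.
by rewrite quotient_distE pseudodist_invariant d_repr.
Qed.

Lemma quotient_translation_action : is_left_action quotient_translation.
Proof.
split=> [a|g h a]; rewrite -(left_cosetK a) !quotient_translationE ?mul1g//.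
by rewrite mulgA.
Qed.

Lemma quotient_translation_isometry : acts_by_isometries quotient_translation.
Proof.
move=> g a b; rewrite -(left_cosetK a) -(left_cosetK b) !quotient_translationE.
rewrite -[LHS]/(quotient_dist _ _) -[RHS]/(quotient_dist _ _) !quotient_distE.
exact: pseudodist_invariant.
Qed.

Lemma quotient_translation_uniform :
  acts_by_uniform_isomorphisms quotient_translation.
Proof.
apply: isometries_uniform quotient_translation_isometry.
exact: quotient_translation_action.
Qed.

End PseudometricQuotient.

(* Main.v *)
Require Import Defs.
From HB Require Import structures.
From mathcomp Require Import all_boot all_order all_algebra.
From mathcomp Require Import all_classical all_reals all_analysis.
From mathcomp Require Import lra.

(** All five conditions are compared with one combinatorial property,
    [finite_RDM]: finitely many bounded uniformly continuous real functions can
    be made simultaneously [e]-constant on a finite set by a translation. For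
    actions that are uniformly equicontinuous, such as left translations of [G]
    and actions by isometries, it is equivalent to the
    Ramsey--Dvoretzky--Milman property ([RDM_finite_RDM], [finite_RDM_RDM]), and
    it passes along equivariant uniformly continuous surjections
    ([finite_RDM_equivariant]).

    Extreme amenability gives the property for [G] with its left uniformity. If
    [f] is bounded and left uniformly continuous, the pointwise closure of its
    left translates [f (g * _)] is compact, and [G] acts on it continuously since
    all its members share one modulus of left uniform continuity. A fixed point
    is a constant function, and a constant in the closure says that translates
    of [f] are nearly constant on any given finite set
    ([fixed_point_finite_RDM]).

    The property then descends from [G] to each quotient [G/d], hence to every
    transitive isometric [G]-space, which is the quotient of [G] by the
    pseudometric induced along an orbit map ([finite_RDM_orbit]). In particular
    it holds for the [G/d] with [d] bounded, and these [d] generate the topology: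
    the pseudometrics [sup_k |f (k * x) - f (k * y)|] with [f] bounded and left
    uniformly continuous already do ([bounded_pseudometrics_generate]).

    Conversely, if the property holds for all [G/d] with [d] in a generating
    family, it holds for [G], because left uniformly continuous functions are
    uniform limits of functions that are Lipschitz for some [d] in the family
    ([generating_pseudometrics_finite_RDM]). Finally, let [G] act on a compactum
    with a point [x0]. For a continuous function [f] on it, [h |-> f (h^-1 x0)]
    is left uniformly continuous, so the property yields points of the orbit
    which finitely many given functions do not distinguish from their images
    under finitely many given group elements; by compactness there is a
    fixed point ([finite_RDM_fixed_point]). *)

Set Implicit Arguments.
Unset Strict Implicit.
Unset Printing Implicit Defensive.

Import Order.TTheory GRing.Theory Num.Theory.
Import numFieldNormedType.Exports.

Local Open Scope classical_set_scope.
Local Open Scope ring_scope.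

(** * Compactness and uniform continuity *)

(** The near-covering form of compactness, applied to the filter of finite
    subsets of [K] directed by inclusion, yields finite subcovers without a base
    point for [X]. *)
Lemma compact_finite_subcover (X : topologicalType) (K : set X)
    (U : X -> set X) :
  compact K -> (forall x, K x -> nbhs x (U x)) ->
  exists s : seq X, (forall x, x \in s -> K x) /\
    K `<=` [set y | exists2 x, x \in s & U x y].
Proof.
move=> /compact_near_coveringP cK nU.
pose F : set_system (seq X) := filter_from
  [set s : seq X | forall x, x \in s -> K x]
  (fun s => [set t | (forall x, x \in t -> K x) /\ {subset s <= t}]).
have FF : ProperFilter F.
  apply: filter_from_proper; last by move=> s sK; exists s; split.
  apply: filter_from_filter; first by exists [::].
  move=> s t sK tK; exists (s ++ t).
    by move=> x; rewrite mem_cat => /orP[/sK|/tK].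
  by move=> r [rK sub]; split; split=> // x xs; apply: sub;
    rewrite mem_cat xs ?orbT.
have cov : \forall s \near F, K `<=` [set y | exists2 x, x \in s & U x y].
  apply: (cK _ F (fun s y => exists2 x, x \in s & U x y)) => x Kx.
  exists (U x, [set t | (forall y, y \in t -> K y) /\ {subset [:: x] <= t}]).
    split; first exact: nU.
    by exists [:: x] => // y; rewrite inE => /eqP ->.
  move=> [y t] /= [Uxy [tK sub]]; exists x => //.
  by apply: sub; rewrite inE.
have sK : \forall s \near F, forall x, x \in s -> K x.
  by exists [::] => // s [].
by have [s [? ?]] := filter_ex (filterI sK cov); exists s.
Qed.

Lemma unif_continuousPnorm (R : realType) (X : uniformType)
    (f : X -> R) :
  unif_continuous f <->
  forall e, 0 < e -> entourage [set p | `|f p.1 - f p.2| < e].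
Proof.
split=> [uf e e0|uf A].
  by apply: uf (entourage_ball R (PosNum e0)).
rewrite -entourage_ballE => -[e /= e0 eA].
by apply: filterS (uf e e0) => p pe; apply: eA.
Qed.

Lemma unif_continuous_coordP (R : realType) (X : uniformType) n
    (f : X -> 'rV[R]_n) :
  unif_continuous f <-> forall i, unif_continuous (fun x => f x ord0 i).
Proof.
split=> [uf i A eA|uf A [B eB sBA]].
  apply: (uf [set p : 'rV[R]_n * 'rV[R]_n | A (p.1 ord0 i, p.2 ord0 i)]).
  by exists (fun _ j => if j == i then A else setT) => [? j|p /(_ ord0 i)] /=;
    [case: ifP => // _; exact: filterT|rewrite eqxx].
have : \forall p \near entourage,
    forall i, B ord0 i (f p.1 ord0 i, f p.2 ord0 i).
  by apply: filter_forall => i; exact: uf (eB ord0 i).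
by apply: filterS => p Bp; apply: sBA => /= i j; rewrite ord1.
Qed.

Lemma euclidean_norm_coord (R : realType) n (u : 'rV[R]_n) i :
  `|u ord0 i| <= euclidean_norm u.
Proof.
rewrite /euclidean_norm -sqrtr_sqr ler_wsqrtr// (bigD1 i)//= lerDl.
by apply: sumr_ge0 => j _; exact: sqr_ge0.
Qed.

Lemma euclidean_norm_le (R : realType) n (u : 'rV[R]_n) (c : R) :
  (forall i, `|u ord0 i| <= c) -> euclidean_norm u <= n%:R * `|c|.
Proof.
move=> uc; have nc0 : 0 <= n%:R * `|c| by rewrite mulr_ge0.
rewrite /euclidean_norm -[leRHS]ger0_norm// -sqrtr_sqr ler_wsqrtr//.
case: n u uc {nc0} => [|n] u uc; first by rewrite big_ord0 sqr_ge0.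
rewrite (@le_trans _ _ (\sum_(i < n.+1) `|c| ^+ 2))//.
  apply: ler_sum => i _; rewrite -real_normK ?num_real// lerXn2r ?nnegrE//.
  by rewrite (le_trans (uc i))// ler_norm.
rewrite sumr_const card_ord exprMn -[leLHS]mulr_natl ler_wpM2r ?sqr_ge0//.
by rewrite -natrX ler_nat leq_pmulr.
Qed.

(** * Oscillation on finite sets *)

(** The form of the Ramsey--Dvoretzky--Milman property in which everything is
    proved: [f] is given by its coordinates, so that no norm on the target is
    involved, and finite subsets replace compact ones. *)
Definition finite_RDM (R : realType) (G : groupType) (X : uniformType)
    (act : G -> X -> X) :=
  forall (n : nat) (f : 'I_n -> X -> R),
    (forall i, exists M : R, forall x, `|f i x| <= M) ->
    (forall i, unif_continuous (f i)) ->
    forall (e : R) (s : seq X), 0 < e ->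
    exists g : G, forall i x y, x \in s -> y \in s ->
      `|f i (act g x) - f i (act g y)| < e.

(** Stronger than acting by uniform isomorphisms, since one entourage serves all
    group elements; this uniformity is what lets finite sets control compact
    ones. *)
Definition uniformly_equicontinuous_action (G : groupType) (X : uniformType)
    (act : G -> X -> X) :=
  forall A, entourage A -> exists2 B, entourage B &
    forall g (p : X * X), B p -> A (act g p.1, act g p.2).

Lemma isometric_action_equicontinuous (R : realType) (G : groupType)
    (X : metricType R) (act : G -> X -> X) :
  acts_by_isometries act -> uniformly_equicontinuous_action act.
Proof.
move=> iso A; rewrite -entourage_ballE => -[e e0 sA].
exists [set p | ball p.1 e p.2]; first by exists e.
move=> g [x y] /=; rewrite ballEmdist /= => xy; apply: sA => /=.
by rewrite ballEmdist /= iso.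
Qed.

(** [(g * x)^-1 * (g * y) = x^-1 * y]: left translations preserve each basic
    left entourage. *)
Lemma left_translation_equicontinuous (G : topologicalGroupType) :
  uniformly_equicontinuous_action (@left_translation G).
Proof.
move=> A [V nV sVA]; exists [set p : G * G | V (p.1^-1 * p.2)%g].
  by exists V.
move=> g [x y] /= Vxy; apply: sVA => /=.
by rewrite /left_translation invgM mulgA mulgVK.
Qed.

Lemma RDM_finite_RDM (R : realType) (G : groupType) (X : uniformType)
    (act : G -> X -> X) : RDM_property R act -> finite_RDM R act.
Proof.
move=> rdm n f bf uf e s e0; have /choice[M fM] := bf.
pose F x : 'rV[R]_n := \row_i f i x.
have [|||g] := rdm n F _ _ e [set` s] e0.
- exists (n%:R * `|\sum_i `|M i| |) => x; apply: euclidean_norm_le => i.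
  rewrite mxE (le_trans (fM i x))// (bigD1 i)//= (le_trans (ler_norm _))//.
  by rewrite lerDl sumr_ge0.
- apply/unif_continuous_coordP => i.
  by rewrite (_ : (fun x => _) = f i) //; apply/funext => x; rewrite mxE.
- by apply: finite_compact; exact: finite_seq.
- move=> osc; exists g => i x y xs ys; rewrite -lte_fin.
  apply: le_lt_trans osc; apply: ereal_sup_ge.
  exists (euclidean_norm (F (act g x) - F (act g y)))%:E.
    by exists (act g x, act g y) => //; split; [exists x|exists y].
  rewrite lee_fin; apply: le_trans (euclidean_norm_coord _ i).
  by rewrite !mxE.
Qed.

(** Choose [B] such that [f \o act g] moves by less than [d] on [B]-close points
    for every [g] at once. A finite [B]-net of [K] on which some translate of
    [f] is [d]-constant then makes that translate [3 * d]-constant on [K]. *)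
Lemma finite_RDM_RDM (R : realType) (G : groupType) (X : uniformType)
    (act : G -> X -> X) : uniformly_equicontinuous_action act ->
  finite_RDM R act -> RDM_property R act.
Proof.
move=> eqc rdm n f [M fM] /unif_continuous_coordP uf e K e0 cK.
(* If all coordinates oscillate by at most [c], then the Euclidean norm
   oscillates by at most [n * c], which is below [e]. *)
pose c := e / (2 * n.+1%:R); pose d := c / 3.
have n0 : 0 < 2 * n.+1%:R :> R by rewrite mulr_gt0.
have d0 : 0 < d by rewrite !divr_gt0.
have [B eB Bact] : exists2 B, entourage B & forall g (p : X * X), B p ->
    forall i, `|f (act g p.1) ord0 i - f (act g p.2) ord0 i| < d.
  apply: (eqc [set p | forall i, `|f p.1 ord0 i - f p.2 ord0 i| < d]).
  apply: filter_forall => i.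
  exact: (iffLR (unif_continuousPnorm _) (uf i)).
have [s [sK sB]] := compact_finite_subcover cK
  (fun x _ => nbhs_entourage x eB).
have [|g gs] := rdm n (fun i x => f x ord0 i) _ uf d s d0.
  by move=> i; exists M => x; exact: le_trans (euclidean_norm_coord _ _) (fM x).
exists g; apply: (@le_lt_trans _ _ (n%:R * `|d + d + d|)%:E); last first.
  rewrite lte_fin ger0_norm ?addr_ge0 ?ltW//.
  have -> : d + d + d = c by rewrite /d; lra.
  rewrite /c mulrCA gtr_pMr// ltr_pdivrMr// mul1r -natrM ltr_nat.
  by rewrite mul2n -addnn ltnS leq_addr.
apply: ge_ereal_sup => _ [[_ _] /= [[x Kx <-] [y Ky <-]] <-].
rewrite lee_fin; apply: euclidean_norm_le => i; rewrite !mxE ltW//.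
have [a /= as_ /xsectionP Bax] := sB x Kx.
have [b /= bs /xsectionP Bby] := sB y Ky.
have := Bact g (a, x) Bax i; have := Bact g (b, y) Bby i.
have := gs i a b as_ bs => /=; rewrite !ltr_norml.
move=> /andP[h1 h2] /andP[h3 h4] /andP[h5 h6]; apply/andP; split; lra.
Qed.

(** A function on [Y] pulls back along [p], and a finite subset of [Y] lifts
    along [p]. The lift is the reason for working with finite sets: a compact
    subset of [Y] need not be the image of a compact subset of [X]. *)
Lemma finite_RDM_equivariant (R : realType) (G : groupType)
    (X Y : uniformType) (actX : G -> X -> X) (actY : G -> Y -> Y)
    (p : X -> Y) :
  unif_continuous p -> (forall y, exists x, p x = y) ->
  (forall g x, p (actX g x) = actY g (p x)) ->
  finite_RDM R actX -> finite_RDM R actY.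
Proof.
move=> up surj equi rdm n f bf uf e s e0.
have /choice[q qK] := surj.
have [||g gs] := rdm n (fun i x => f i (p x)) _ _ e (map q s) e0.
- by move=> i; have [M fM] := bf i; exists M.
- move=> i A /uf /up; exact.
- exists g => i x y xs ys.
  have := gs i (q x) (q y) (map_f q xs) (map_f q ys).
  by rewrite /= !equi !qK.
Qed.

(** * From fixed points to nearly constant translates *)

Lemma cvg_mulg (G : topologicalGroupType) (T : Type) (F : set_system T)
    {FF : Filter F} (f g : T -> G) (a b : G) :
  f @ F --> a -> g @ F --> b -> (f x * g x)%g @[x --> F] --> (a * b)%g.
Proof.
move=> fa gb.
apply: (@cvg_comp _ _ _ (fun x => (f x, g x)) (fun p : G * G => (p.1 * p.2)%g)
  F (nbhs (a, b))); first exact: cvg_pair.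
exact: (@mulg_continuous G (a, b)).
Qed.

Lemma prod_topology_continuous (I : Type) (T : I -> topologicalType)
    (X : topologicalType) (f : X -> prod_topology T) :
  (forall i, continuous (fun x => f x i)) -> continuous f.
Proof.
move=> cf x; apply/cvg_sup => i.
have : continuous (f : X -> initial_topology (fun p : prod_topology T => p i)).
  by apply: continuous_comp_initial; exact: cf.
by move=> /(_ x).
Qed.

Lemma set_val_continuous (X : topologicalType) (A : set X) :
  continuous (fun x : A => set_val x).
Proof. exact: initial_continuous. Qed.

(** A cluster point of the image filter lies in [A], and it is a cluster point
    upstairs because the open sets of [A] are traces of open sets of [X]. *)
Lemma compact_set_type (X : topologicalType) (A : set X) :
  compact A -> compact [set: A].
Proof.
move=> cA F PF _.
have FA : (set_val @ F) A by apply: (@filterE _ F) => x; exact: set_valP.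
have [p [Ap cp]] := cA (set_val @ F) _ FA.
exists (SigSub (mem_set Ap)); split=> // B U FB [_ [[W oW <-] Wp sWU]].
have [||_ [[x Bx <-] Wx]] := cp (set_val @` B) W.
- by apply: (@filterS _ F _ _ _ _ FB) => x Bx; exists x.
- by apply: open_nbhs_nbhs; split.
- by exists x; split=> //; exact: sWU.
Qed.

(** Neighbourhoods that separate two points of [X] restrict to [A]. *)
Lemma hausdorff_set_type (X : topologicalType) (A : set X) :
  hausdorff_space X -> hausdorff_space A.
Proof.
move=> hX p q pq; apply: val_inj; apply: hX => U V pU qV.
have [x [Ux Vx]] := pq _ _ (@set_val_continuous X A p U pU)
  (@set_val_continuous X A q V qV).
by exists (set_val x).
Qed.

Lemma pointwise_nbhs_finite (R : realType) (J : eqType) (p : {ptws J -> R})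
    (t : seq J) (e : R) : 0 < e ->
  nbhs p [set q : {ptws J -> R} | forall j, j \in t -> `|p j - q j| < e].
Proof.
move=> e0; elim: t => [|j t ih]; first by apply: filterE.
have pc : (fun q : {ptws J -> R} => q j) @ p --> p j.
  exact: (@proj_continuous J (fun=> R) j p).
have nj : nbhs p [set q : {ptws J -> R} | `|p j - q j| < e].
  exact: (pc _ (nbhsx_ballx (p j) e e0)).
apply: filterS (filterI nj ih) => q [qj qt] k.
by rewrite inE => /predU1P[->|/qt].
Qed.

Section LeftTranslates.
Variables (R : realType) (G : topologicalGroupType) (n : nat).
Variable f : 'I_n -> G -> R.

(** The pointwise closure of the orbit of [f] under [g |-> f (g * _)], spelled
    out by finite sets of coordinates so that every later estimate can start
    from an actual translate of [f]. The [n] functions are packed into one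
    real-valued function on [G * 'I_n]. *)
Definition translate_hull : set {ptws (G * 'I_n)%type -> R} :=
  [set p | forall (t : seq (G * 'I_n)) (e : R), 0 < e ->
    exists g : G, forall j, j \in t -> `|p j - f j.2 (g * j.1)%g| < e].

Lemma translate_in_hull g : translate_hull (fun j => f j.2 (g * j.1)%g).
Proof. by move=> t e e0; exists g => j _; rewrite subrr normr0. Qed.

Lemma translate_hull_closed : closed translate_hull.
Proof.
move=> p clp t e e0; have e2 : 0 < e / 2 by rewrite divr_gt0.
have [q [hq pq]] := clp _ (pointwise_nbhs_finite p t e2).
have [g gq] := hq t _ e2; exists g => j jt.
have := pq j jt; have := gq j jt; rewrite !ltr_norml => /andP[? ?] /andP[? ?].
by apply/andP; split; lra.
Qed.

Lemma translate_hull_compact :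
  (forall i, exists M : R, forall x, `|f i x| <= M) -> compact translate_hull.
Proof.
move=> /choice[M fM].
apply: (subclosed_compact translate_hull_closed
  (tychonoff (fun j : G * 'I_n => @segment_compact R (- M j.2) (M j.2)))).
move=> p hp j; rewrite /= in_itv /= -ler_norml; apply/ler_addgt0Pl => e e0.
have [g /(_ j (mem_head _ _))] := hp [:: j] e e0.
have := fM j.2 (g * j.1)%g; rewrite ler_norml ltr_norml.
by rewrite ler_norml => /andP[? ?] /andP[? ?]; apply/andP; split; lra.
Qed.

(** Precomposition with left translations is a right action, whence the
    inverse. *)
Definition hull_shift (h : G) (p : {ptws (G * 'I_n)%type -> R}) :
  {ptws (G * 'I_n)%type -> R} := fun j => p (h^-1 * j.1, j.2)%g.

Lemma hull_shift_hull h p : translate_hull p -> translate_hull (hull_shift h p).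
Proof.
move=> hp t e e0.
have [g gp] := hp [seq (h^-1 * j.1, j.2)%g | j <- t] e e0.
exists (g * h^-1)%g => j jt; have := gp _ (map_f _ jt).
by rewrite /= mulgA.
Qed.

Definition hull_action (h : G) (p : translate_hull) : translate_hull :=
  SigSub (mem_set (hull_shift_hull h (set_valP p))).

(** Every member of the hull is left uniformly continuous with the modulus of
    [f], as a limit of left translates. Since [(h0^-1 * k)^-1 * (h^-1 * k)]
    tends to [1] as [h] tends to [h0], the value at [h^-1 * k] is close to the
    value at [h0^-1 * k] uniformly over the hull; hence the joint continuity. *)
Lemma hull_action_continuous :
  (forall i, unif_continuous (f i : left_uniform G -> R)) ->
  continuous_action hull_action.
Proof.
move=> uf; split; first split=> [p|g h p]; first 2 last.
- apply: continuous_comp_initial; apply: prod_topology_continuous => -[k i].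
  move=> [h0 p0]; apply/cvgrPdist_lt => e e0.
  have e4 : 0 < e / 4 by rewrite divr_gt0.
  have [V nV sV] := iffLR (unif_continuousPnorm _) (uf i) _ e4.
  exists ([set h | V ((h0^-1 * k)^-1 * (h^-1 * k))%g],
    [set p : translate_hull |
      `|set_val p0 (h0^-1 * k, i)%g - set_val p (h0^-1 * k, i)%g| < e / 4]).
    split.
      have : ((h0^-1 * k)^-1 * (h^-1 * k))%g @[h --> h0] --> (1 : G)%g.
        rewrite -(mulVg (h0^-1 * k)%g); apply: cvg_mulg; first exact: cvg_cst.
        by apply: cvg_mulg; [exact: invg_continuous|exact: cvg_cst].
      by move=> /(_ V nV).
    have nq : nbhs p0 [set p : translate_hull | forall j,
        j \in [:: (h0^-1 * k, i)%g] -> `|set_val p0 j - set_val p j| < e / 4].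
      exact: (@set_val_continuous _ _ p0 _ (pointwise_nbhs_finite _ _ e4)).
    apply: (@filterS _ (nbhs p0) _ _ _ _ nq) => q pq.
    exact: pq (mem_head _ _).
  move=> [h p] /= [Vh pp0].
  have hp : translate_hull (set_val p) := set_valP p.
  have [g gp] := hp [:: (h0^-1 * k, i)%g; (h^-1 * k, i)%g] _ e4.
  have := gp _ (mem_head _ _); have := gp (h^-1 * k, i)%g.
  rewrite !inE eqxx orbT => /(_ isT) /=.
  have := sV ((g * (h0^-1 * k))%g, (g * (h^-1 * k))%g) => /=.
  rewrite invgM mulgA mulgVK => /(_ Vh).
  move: pp0; rewrite /hull_action /= /hull_shift !ltr_norml.
  move=> /andP[? ?] /andP[? ?] /andP[? ?] /andP[? ?].
  by apply/andP; split; lra.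
- apply: val_inj; apply/funext => -[k i] /=.
  by rewrite /hull_shift /= invg1 mul1g.
- apply: val_inj; apply/funext => -[k i] /=.
  by rewrite /hull_shift /= invgM mulgA.
Qed.

Lemma fixed_in_hull_constant (p : translate_hull) :
  (forall h, hull_action h p = p) ->
  forall k i, set_val p (k, i) = set_val p (1%g, i).
Proof.
move=> fixp k i; rewrite -[in LHS](fixp k).
by rewrite -[LHS]/(hull_shift k (set_val p) (k, i)) /hull_shift mulVg.
Qed.

End LeftTranslates.

(** A fixed point of the hull is a constant function [c]. Being in the hull, it
    is approximated on any finite set by a translate of [f], which is therefore
    nearly constant there. *)
Lemma fixed_point_finite_RDM (R : realType) (G : topologicalGroupType) :
  fixed_point_on_compacta G -> finite_RDM R (@left_translation G).
Proof.
move=> fpc n f bf uf e s e0.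
have [||||p fixp] := fpc (translate_hull f) (@hull_action R G n f).
- by exists (SigSub (mem_set (translate_in_hull f 1%g))).
- exact/compact_set_type/translate_hull_compact.
- apply: hausdorff_set_type; apply: hausdorff_product => _.
  exact: Rhausdorff.
- exact: hull_action_continuous.
have hp : translate_hull f (set_val p) := set_valP p.
have e2 : 0 < e / 2 by rewrite divr_gt0.
have [g gp] := hp [seq (x, i) | x <- s, i <- enum 'I_n] _ e2.
exists g => i x y xs ys.
have := gp (x, i) (allpairs_f _ xs (mem_enum _ i)).
have := gp (y, i) (allpairs_f _ ys (mem_enum _ i)).
rewrite !(fixed_in_hull_constant fixp) /left_translation /= !ltr_norml.
by move=> /andP[? ?] /andP[? ?]; apply/andP; split; lra.
Qed.

(** * From nearly constant translates to fixed points *)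

Lemma compact_hausdorff_separation (R : realType) (X : topologicalType)
    (x y : X) : compact [set: X] -> hausdorff_space X -> x <> y ->
  exists f : X -> R, [/\ continuous f, forall z, `|f z| <= 1,
    f x = 0 & f y = 1].
Proof.
move=> cX hX xy.
have cl1 := accessible_closed_set1 (hausdorff_accessible hX).
have sep : uniform_separator [set x] [set y].
  apply: (iffLR (@normal_separatorP R X)) => //; first exact: compact_normal.
  by rewrite -subset0 => z [-> ]; exact: xy.
exists (@Urysohn X R [set x] [set y]); split.
- exact: Urysohn_continuous.
- move=> z.
  have : range (@Urysohn X R [set x] [set y]) (Urysohn [set x] [set y] z).
    by exists z.
  move=> /Urysohn_range; rewrite /= in_itv /= => /andP[z0 z1].
  by rewrite ger0_norm.
- by apply: (@Urysohn_sub0 X R _ _ sep); exists x.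
- by apply: (@Urysohn_sub1 X R _ _ sep); exists y.
Qed.

Section ContinuousActions.
Variables (G : topologicalGroupType) (X : topologicalType).
Variable act : G -> X -> X.
Hypothesis act_cts : continuous_action act.

Lemma cvg_action (T : Type) (F : set_system T) {FF : Filter F}
    (g : T -> G) (p : T -> X) (a : G) (x : X) :
  g @ F --> a -> p @ F --> x -> act (g t) (p t) @[t --> F] --> act a x.
Proof.
move=> ga px.
apply: (@cvg_comp _ _ _ (fun t => (g t, p t)) (fun q : G * X => act q.1 q.2)
  F (nbhs (a, x))); first exact: cvg_pair.
exact: (act_cts.2 (a, x)).
Qed.

(** The inverse makes the map left uniformly continuous: if [k = h * v], then
    [k^-1 x0 = v^-1 y] with [y = h^-1 x0], and by compactness [f (v^-1 y)] is
    close to [f y] uniformly in [y] when [v] is close to [1]. *)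
Lemma orbit_map_unif_continuous (R : realType) (f : X -> R) (x0 : X) :
  compact [set: X] -> continuous f ->
  unif_continuous (fun h : left_uniform G => f (act (h : G)^-1%g x0)).
Proof.
move=> cX cf; have [[act1 actM] _] := act_cts.
apply/unif_continuousPnorm => e e0.
exists [set v : G | forall y, `|f y - f (act v^-1%g y)| < e]; last first.
  move=> [h k] /= /(_ (act h^-1%g x0)).
  by rewrite -actM invgM invgK mulgK.
have : \forall v \near (1%g : G), [set: X] `<=`
    [set y | `|f y - f (act v^-1%g y)| < e].
  apply: (iffLR (compact_near_coveringP _) cX _ _
    (fun (v : G) y => `|f y - f (act v^-1%g y)| < e)) => x _.
  pose D (p : X * G) := f p.1 - f (act p.2^-1%g p.1).
  have : D p @[p --> (x, 1%g : G)] --> 0.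
    rewrite -(subrr (f x)); apply: cvgB.
      by apply: (cvg_comp fst f (G := nbhs x)); [exact: cvg_fst|exact: cf].
    have : act p.2^-1%g p.1 @[p --> (x, 1%g : G)] --> act 1^-1%g x.
      apply: cvg_action; last exact: cvg_fst.
      apply: (cvg_comp snd (fun v : G => v^-1%g) (G := nbhs (1%g : G))).
        exact: cvg_snd.
      exact: invg_continuous.
    rewrite invg1 act1 => cact.
    exact: (cvg_comp (fun p : X * G => act p.2^-1%g p.1) f cact (cf x)).
  by move=> /cvgr0Pnorm_lt/(_ e e0).
by apply: filterS => v fv y; exact: fv.
Qed.

End ContinuousActions.

(** If no point is fixed, each [x] is moved by some [g x], and a continuous [f x]
    takes the values [0] at [x] and [1] at [g x * x]; it still tells [y] from
    [g x * y] for [y] in a neighbourhood [U x]. Finitely many [U a] cover the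
    space. The property, applied to the maps [h |-> f a (h^-1 x0)] and to the
    finite set of all [(g a)^-1] together with [1], gives a point
    [y = h^-1 x0] at which no [f a] distinguishes [y] from [g a * y]. *)
Lemma finite_RDM_fixed_point (R : realType) (G : topologicalGroupType) :
  finite_RDM R (@left_translation G) -> fixed_point_on_compacta G.
Proof.
move=> rdm X act [x0 _] cX hX actc; have [[act1 actM] _] := actc.
apply: contrapT => /forallNP nofix.
have /choice[g gP] : forall x, exists g, act g x <> x.
  by move=> x; apply/existsNP.
have /choice[f fP] : forall x, exists f : X -> R, [/\ continuous f,
    forall z, `|f z| <= 1, f x = 0 & f (act (g x) x) = 1].
  move=> x; apply: compact_hausdorff_separation => //.
  by move=> xE; apply: (gP x).
pose U x := [set y | f x y < 1 / 3 /\ 2 / 3 < f x (act (g x) y)].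
have nU x : [set: X] x -> nbhs x (U x).
  move=> _; have [cf _ fx0 fx1] := fP x; apply: filterI.
    by apply: (cvgr_lt _ (cf x)); rewrite fx0; lra.
  have cg : f x (act (g x) y) @[y --> x] --> f x (act (g x) x).
    apply: (cvg_comp (act (g x)) (f x) (G := nbhs (act (g x) x)));
      last exact: cf.
    by apply: (cvg_action actc); [exact: cvg_cst|exact: cvg_id].
  by apply: (cvgr_gt _ cg); rewrite fx1; lra.
have [s [_ sU]] := compact_finite_subcover cX nU.
pose t := in_tuple s.
have [|||h hP] := rdm (size s) (fun i k => f (tnth t i) (act k^-1%g x0)) _ _
    (1 / 3) (1%g :: [seq (g x)^-1%g | x <- s]).
- by move=> i; exists 1 => k; have [] := fP (tnth t i).
- move=> i; apply: (orbit_map_unif_continuous actc) => //.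
  by have [] := fP (tnth t i).
- by rewrite divr_gt0.
have [a /= ats [fa fga]] := sU (act h^-1%g x0) I.
have [i aE] : exists i, a = tnth t i by exact/tnthP.
have ga : (g a)^-1%g \in [seq (g x)^-1%g | x <- s].
  by exact: map_f.
have := hP i 1%g (g a)^-1%g (mem_head _ _).
rewrite inE ga orbT => /(_ isT).
rewrite /left_translation mulg1 invgM invgK actM -aE.
by rewrite ltr_norml => /andP[? ?]; lra.
Qed.

(** * Lipschitz approximation and quotients by pseudometrics *)

Section LipschitzEnvelope.
Variables (R : realType) (T : Type) (d : T -> T -> R) (f : T -> R) (L M : R).
Hypotheses (d_ge0 : forall x y, 0 <= d x y) (dxx : forall x, d x x = 0).
Hypothesis d_triangle : forall y x z, d x z <= d x y + d y z.
Hypotheses (L_ge0 : 0 <= L) (fM : forall x, `|f x| <= M).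

(** The largest [L]-Lipschitz minorant of [f] with respect to [d]. *)
Definition lipschitz_envelope (x : T) : R :=
  inf (range (fun h => f h + L * d x h)).

Lemma envelope_le x h : lipschitz_envelope x <= f h + L * d x h.
Proof.
apply: ge_inf; last by exists h.
exists (- M) => _ [k _ <-]; have := fM k; rewrite ler_norml => /andP[Mf _].
by rewrite -[leLHS]addr0 lerD// mulr_ge0.
Qed.

Lemma le_envelope x c :
  (forall h, c <= f h + L * d x h) -> c <= lipschitz_envelope x.
Proof.
move=> cP; apply: lb_le_inf; first by exists (f x + L * d x x); exists x.
by move=> _ [h _ <-].
Qed.

Lemma envelope_bounded x : `|lipschitz_envelope x| <= M.
Proof.
rewrite ler_norml; apply/andP; split.
  apply: le_envelope => h; have := fM h; rewrite ler_norml => /andP[Mf _].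
  by rewrite -[leLHS]addr0 lerD// mulr_ge0.
have := envelope_le x x; rewrite dxx mulr0 addr0 => /le_trans; apply.
by rewrite (le_trans (ler_norm _)).
Qed.

Lemma envelope_lipschitz x y :
  lipschitz_envelope x <= lipschitz_envelope y + L * d x y.
Proof.
rewrite -lerBlDr; apply: le_envelope => h; rewrite lerBlDr.
apply: le_trans (envelope_le x h) _.
by rewrite -addrA lerD2l -mulrDr ler_wpM2l// addrC.
Qed.

(** Points [h] at distance at least [r] from [x] cannot lower the infimum below
    [f x], since [L * r] is at least [2 * M], which bounds the oscillation
    of [f]; the nearer ones lower it by at most [e]. *)
Lemma envelope_close x e r : 2 * M <= L * r ->
  (forall h, d x h < r -> f x - e <= f h) -> 0 <= e ->
  f x - e <= lipschitz_envelope x <= f x.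
Proof.
move=> MLr near_x e0; apply/andP; split; last first.
  by have := envelope_le x x; rewrite dxx mulr0 addr0.
apply: le_envelope => h; have [xh|rx] := ltP (d x h) r.
  by rewrite -[leLHS]addr0 lerD ?mulr_ge0// near_x.
have := ler_wpM2l L_ge0 rx; have := fM h; have := fM x.
by rewrite !ler_norml => /andP[? ?] /andP[? ?] ?; lra.
Qed.

End LipschitzEnvelope.

Lemma pseudodist_repr (R : realType) (G : topologicalGroupType)
    (d : left_invariant_pseudometric R G) (x : G) :
  d (repr (left_coset d x)) x = 0.
Proof. by rewrite -quotient_distE left_cosetK quotient_distE pseudodistxx. Qed.

(** Maps out of the quotient are given on representatives; this reads their
    uniform continuity on the group itself. *)
Lemma unif_continuous_pseudometric_quotient (R : realType)
    (G : topologicalGroupType) (d : left_invariant_pseudometric R G)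
    (X : uniformType) (f : pseudometric_quotient d -> X) :
  (forall A, entourage A -> exists2 e, 0 < e &
     forall a b, d (repr a) (repr b) < e -> A (f a, f b)) ->
  unif_continuous f.
Proof.
move=> uf A /uf[e e0 fA].
rewrite /nbhs /= -entourage_ballE; exists e => //= -[a b] /= ab.
by apply: fA; move: ab; rewrite ballEmdist.
Qed.

(** A left uniformly continuous [f] need not factor through any [G/d] with [d] in
    [D], but it is uniformly approximated by functions which do. Some ball of
    some [d] in [D] lies in a neighbourhood of [1] witnessing the uniform
    continuity of [f] up to [e / 4], because balls of members of [D] form a base.
    For a large Lipschitz constant the envelope of [f] for this [d] is within
    [e / 4] of [f], and it factors through [G/d], being Lipschitz for [d]. *)
Lemma generating_pseudometrics_finite_RDM (R : realType)
    (G : topologicalGroupType) (D : set (left_invariant_pseudometric R G)) :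
  generates_topology D ->
  (forall d, D d -> finite_RDM R (@quotient_translation R G d)) ->
  finite_RDM R (@left_translation G).
Proof.
move=> gen rdm n f bf uf e s e0; have /choice[N fN] := bf.
have e4 : 0 < e / 4 by rewrite divr_gt0.
pose M := \sum_i `|N i|.
have M0 : 0 <= M by rewrite sumr_ge0.
have fM i x : `|f i x| <= M.
  rewrite (le_trans (fN i x))// /M (bigD1 i)//= (le_trans (ler_norm _))//.
  by rewrite lerDl sumr_ge0.
have [V nV fV] : \forall p \near @entourage (left_uniform G),
    forall i, `|f i p.1 - f i p.2| < e / 4.
  apply: filter_forall => i.
  exact: (iffLR (unif_continuousPnorm _) (uf i)).
have [d [r [Dd r0 dV]]] := iffLR (gen 1%g V) nV.
pose L := 2 * M / r.
have L0 : 0 <= L by rewrite divr_ge0 ?mulr_ge0//; exact: ltW.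
pose F i := lipschitz_envelope d (f i) L.
have Flip i x y : `|F i x - F i y| <= L * d x y.
  have lip := envelope_lipschitz (pseudodist_ge0 d) (pseudodist_triangle d) L0
    (fM i).
  have := lip x y; have := lip y x; rewrite (pseudodist_sym d y x) -/(F i).
  by move=> ? ?; rewrite ler_norml; apply/andP; split; lra.
have Fclose i x : f i x - e / 4 <= F i x <= f i x.
  apply: (envelope_close (pseudodist_ge0 d) (pseudodistxx d) L0 (fM i)
    (r := r)) => [|h xh|]; last exact: ltW.
    by rewrite /L divfK ?gt_eqF.
  have /(fV (_, _))/(_ i) : V (x^-1 * h)%g.
    by apply: dV; rewrite /= -(pseudodist_invariant d x) mulg1 mulVKg.
  by rewrite /= ltr_norml => /andP[? ?]; lra.
have [|||g gP] := rdm d Dd n (fun i a => F i (repr a)) _ _ (e / 4)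
    (map (left_coset d) s).
- move=> i; exists M => a.
  exact: (envelope_bounded (pseudodist_ge0 d) (pseudodistxx d) L0 (fM i)).
- move=> i; apply: unif_continuous_pseudometric_quotient => A.
  rewrite -entourage_ballE => -[c /= c0 sA].
  exists (c / (L + 1)); first by rewrite divr_gt0// ltr_wpDl.
  move=> a b ab; apply: sA; rewrite /ball /= (le_lt_trans (Flip _ _ _))//.
  have L1 : 0 < L + 1 by rewrite ltr_wpDl.
  rewrite ltr_pdivlMr// in ab; apply: le_lt_trans ab.
  by rewrite mulrDr mulr1 mulrC lerDl pseudodist_ge0.
- exact: e4.
(* Points at distance zero have the same envelope, which thus descends to the
   quotient. *)
have Frepr i x : F i (repr (left_coset d x)) = F i x.
  apply/eqP; rewrite -subr_eq0 -normr_le0.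
  by rewrite (le_trans (Flip _ _ _))// pseudodist_repr mulr0.
exists g => i x y xs ys.
have := gP i _ _ (map_f (left_coset d) xs) (map_f (left_coset d) ys).
rewrite !quotient_translationE /= !Frepr /left_translation.
have /andP[? ?] := Fclose i (g * x)%g; have /andP[? ?] := Fclose i (g * y)%g.
by rewrite !ltr_norml => /andP[? ?]; apply/andP; split; lra.
Qed.

(** * Bounded left-invariant pseudometrics generate the topology *)

(** The entourage [E] begins a countable chain of entourages, which defines a
    pseudometric bounded by [2]; [f] is the distance to [x]. Urysohn's lemma
    would only give continuity, whereas uniform continuity is needed to build
    an invariant pseudometric from [f]. *)
Lemma uniform_bump_function (R : realType) (T : uniformType) (E : set (T * T))
    (x : T) : entourage E ->
  exists f : T -> R, exists r : R, [/\ 0 < r, forall y, `|f y| <= 2,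
    f x = 0, forall y, ~ E (x, y) -> r <= f y & unif_continuous f].
Proof.
move=> entE; pose T' : pseudoMetricType R := gauge.type entE.
have bd (y z : T') : (edist (y, z) <= 2%:E)%E.
  apply: edist_fin => //=.
  exact: countable_uniform.countable_uniform_bounded.
have fin (y z : T') : edist (y, z) \is a fin_num.
  by rewrite ge0_fin_numE ?edist_ge0// (le_lt_trans (bd y z))// ltry.
have [r r0 rE] : exists2 r : R, 0 < r &
    forall y z : T', ball y r z -> E (y, z).
  have : @entourage T' E by exists 0%N => // -[y z] [].
  rewrite -entourage_ballE => -[r /= r0 rE]; exists r => // y z yz.
  exact: (rE (y, z)).
pose f (y : T) : R := fine (@edist R T' (x, y)).
have f_lip (y z : T') : f y <= f z + fine (edist (y, z)).
  rewrite /f -fineD ?fin// fine_le ?fin ?fin_numD ?fin//.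
  by rewrite (edist_sym y z) edist_triangle.
exists f, r; split=> //.
- move=> y; rewrite ger0_norm ?fine_ge0 ?edist_ge0//.
  by rewrite -lee_fin fineK.
- by rewrite /f edist_refl.
- move=> y nE; rewrite leNgt; apply/negP => yr; apply: nE; apply: rE.
  by apply: (@edist_lt_ball R T' r (x, y)); rewrite -(fineK (fin x y)) lte_fin.
- apply/unif_continuousPnorm => e e0; apply: (gauge.gauge_ent entE).
  have e2 : 0 < e / 2 by rewrite divr_gt0.
  have ent2 : @entourage T' [set p | ball p.1 (e / 2) p.2].
    exact: (entourage_ball T' (PosNum e2)).
  apply: (@filterS _ _ (gauge.gauge_filter entE) _ _ _ ent2) => -[y z] /= yz.
  have yze : fine (@edist R T' (y, z)) <= e / 2.
    by rewrite -lee_fin fineK//; exact: edist_fin.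
  have := f_lip y z; have := f_lip z y; rewrite (@edist_sym R T' z y) => ? ?.
  by rewrite ltr_norml; apply/andP; split; lra.
Qed.

(** [|d x y - d u v| <= d x u + d y v]. *)
Lemma pseudometric_continuous (R : realType) (X : topologicalType)
    (d : X -> X -> R) :
  (forall x y, d x y = d y x) -> (forall y x z, d x z <= d x y + d y z) ->
  (forall x e, 0 < e -> \forall y \near x, d x y <= e) ->
  continuous (fun p : X * X => d p.1 p.2).
Proof.
move=> dC dT near_d [x y]; apply/cvgrPdist_le => e e0.
have e2 : 0 < e / 2 by rewrite divr_gt0.
exists ([set z | d x z <= e / 2], [set z | d y z <= e / 2]).
  by split; exact: near_d.
move=> [u v] /= [xu yv].
have := dT u x y; have := dT v u y; have := dT x u v; have := dT y x v.
rewrite (dC u x) (dC v y) => ? ? ? ?.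
by rewrite ler_norml; apply/andP; split; lra.
Qed.

Section TranslationPseudometric.
Variables (R : realType) (G : topologicalGroupType).
Variables (f : left_uniform G -> R) (M : R).
Hypotheses (fM : forall x, `|f x| <= M) (uf : unif_continuous f).

(** The supremum over all left translates makes the pullback of the distance of
    [R] along [f] left-invariant; its continuity rests on the left uniform
    continuity of [f], which treats all translates alike. *)
Definition translation_dist (x y : G) : R :=
  sup (range (fun k : G => `|f (k * x)%g - f (k * y)%g|)).

Lemma le_translation_dist k x y :
  `|f (k * x)%g - f (k * y)%g| <= translation_dist x y.
Proof.
apply: ub_le_sup; last by exists k.
exists (M + M) => _ [h _ <-].
by rewrite (le_trans (ler_normB _ _))// lerD.
Qed.

Lemma translation_dist_le x y c :
  (forall k, `|f (k * x)%g - f (k * y)%g| <= c) -> translation_dist x y <= c.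
Proof.
move=> dc; apply: ge_sup; last by move=> _ [k _ <-].
by exists `|f (1 * x)%g - f (1 * y)%g|; exists 1%g.
Qed.

Let dist_ge0 x y : 0 <= translation_dist x y.
Proof. exact: le_trans (le_translation_dist 1%g x y). Qed.

Let distxx x : translation_dist x x = 0.
Proof.
apply/eqP; rewrite eq_le dist_ge0 andbT; apply: translation_dist_le => k.
by rewrite subrr normr0.
Qed.

Let dist_sym x y : translation_dist x y = translation_dist y x.
Proof.
by congr sup; apply/seteqP; split=> _ [k _ <-]; exists k => //; rewrite distrC.
Qed.

Let dist_triangle y x z :
  translation_dist x z <= translation_dist x y + translation_dist y z.
Proof.
apply: translation_dist_le => k.
rewrite (le_trans (ler_distD (f (k * y)%g) _ _))//.
by rewrite lerD// le_translation_dist.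
Qed.

Let dist_invariant g x y :
  translation_dist (g * x)%g (g * y)%g = translation_dist x y.
Proof.
congr sup; apply/seteqP; split=> _ [k _ <-].
  by exists (k * g)%g; rewrite ?mulgA.
by exists (k * g^-1)%g; rewrite // !mulgA !mulgVK.
Qed.

Let dist_continuous :
  continuous (fun p : G * G => translation_dist p.1 p.2).
Proof.
apply: pseudometric_continuous => // x e e0.
have [V nV sV] := iffLR (unif_continuousPnorm _) uf e e0.
have cx : (x^-1 * y)%g @[y --> x] --> (1 : G)%g.
  rewrite -(mulVg x); apply: cvg_mulg; [exact: cvg_cst|exact: cvg_id].
have nx : nbhs x [set y | V (x^-1 * y)%g] := cx V nV.
apply: filterS nx => y Vxy.
apply: translation_dist_le => k; apply: ltW.
by apply: (sV ((k * x)%g, (k * y)%g)); rewrite /= invgM mulgA mulgVK.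
Qed.

Definition translation_pseudometric : left_invariant_pseudometric R G :=
  LeftInvariantPseudometric dist_ge0 distxx dist_sym dist_triangle
    dist_invariant dist_continuous.

Lemma translation_pseudometric_bounded :
  bounded_pseudometric translation_pseudometric.
Proof.
exists (M + M) => x y; apply: translation_dist_le => k.
by rewrite (le_trans (ler_normB _ _))// lerD.
Qed.

End TranslationPseudometric.

(** For a neighbourhood [U] of [x], take [f] left uniformly continuous with
    [f x = 0] and [f >= r] off [U]. Its translation pseudometric is at least
    [|f x - f y| >= r] when [y] is outside [U]. *)
Lemma bounded_pseudometrics_generate (R : realType)
    (G : topologicalGroupType) :
  generates_topology
    [set d : left_invariant_pseudometric R G | bounded_pseudometric d].
Proof.
move=> x U; split=> [nU|[d [e [_ e0 dU]]]]; last first.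
  have : d x y @[y --> x] --> d x x.
    apply: (cvg_comp (fun y => (x, y)) (fun p : G * G => d p.1 p.2)
      (G := nbhs (x, x))); last exact: (@pseudodist_continuous _ _ d (x, x)).
    by apply: cvg_pair; [exact: cvg_cst|exact: cvg_id].
  rewrite pseudodistxx => /cvgr_lt/(_ e e0).
  by apply: filterS => y; exact: dU.
pose E : set (left_uniform G * left_uniform G) :=
  [set p | U (x * ((p.1 : G)^-1 * p.2))%g].
have entE : entourage E.
  exists [set v : G | U (x * v)%g] => //.
  have : (x * v @[v --> 1] --> (x * 1 : G))%g.
    by apply: cvg_mulg; [exact: cvg_cst|exact: cvg_id].
  by rewrite mulg1 => /(_ U nU).
have [f [r [r0 f2 fx fr uf]]] :=
  uniform_bump_function R (x : left_uniform G) entE.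
exists (translation_pseudometric f2 uf), r; split=> //.
  exact: translation_pseudometric_bounded.
move=> y /= dxy; apply: contrapT => nUy.
have ry : r <= f y by apply: fr; rewrite /E /= mulVKg.
have := le_translation_dist f2 1%g x y; rewrite !mul1g fx sub0r normrN.
rewrite leNgt => /negP; apply; rewrite (lt_le_trans dxy)// (le_trans ry)//.
exact: ler_norm.
Qed.

(** * Quotients by pseudometrics and transitive isometric actions *)

Lemma left_coset_unif_continuous (R : realType) (G : topologicalGroupType)
    (d : left_invariant_pseudometric R G) :
  unif_continuous (fun x : left_uniform G => left_coset d x).
Proof.
move=> A; rewrite -entourage_ballE => -[e /= e0 sA].
have : d 1%g v @[v --> (1 : G)%g] --> d 1%g 1%g.
  apply: (cvg_comp (fun v : G => (1%g : G, v)) (fun p : G * G => d p.1 p.2)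
    (G := nbhs (1%g : G, 1%g : G)));
    last exact: (@pseudodist_continuous _ _ d (1%g, 1%g)).
  by apply: cvg_pair; [exact: cvg_cst|exact: cvg_id].
rewrite pseudodistxx => /cvgr_lt/(_ e e0) nV.
exists [set v | d 1%g v < e] => // -[x y] /= xy; apply: sA => /=.
rewrite ballEmdist /= -[mdist _ _]/(quotient_dist _ _) quotient_distE.
by rewrite -(pseudodist_invariant d x^-1%g) mulVg.
Qed.

Lemma finite_RDM_pseudometric_quotient (R : realType)
    (G : topologicalGroupType) (d : left_invariant_pseudometric R G) :
  finite_RDM R (@left_translation G) ->
  finite_RDM R (@quotient_translation R G d).
Proof.
apply: (finite_RDM_equivariant (left_coset_unif_continuous (d := d))).
  by move=> a; exists (repr a); exact: left_cosetK.
by move=> g x; rewrite quotient_translationE.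
Qed.

Lemma quotient_translation_continuous (R : realType)
    (G : topologicalGroupType) (d : left_invariant_pseudometric R G) :
  continuous_action (@quotient_translation R G d).
Proof.
split; first exact: quotient_translation_action.
move=> [g a]; apply/metricType_numDomainType.cvgrPdist_lt => e e0.
have e2 : 0 < e / 2 by rewrite divr_gt0.
have : d (g * repr a)%g (h * repr a)%g @[h --> g] -->
    d (g * repr a)%g (g * repr a)%g.
  apply: (cvg_comp (fun h => ((g * repr a)%g, (h * repr a)%g))
    (fun p : G * G => d p.1 p.2)
    (G := nbhs ((g * repr a)%g, (g * repr a)%g)));
    last exact: (@pseudodist_continuous _ _ d (_, _)).
  apply: cvg_pair; first exact: cvg_cst.
  by apply: cvg_mulg; [exact: cvg_id|exact: cvg_cst].
rewrite pseudodistxx => /cvgr_lt/(_ (e / 2) e2) ng.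
exists ([set h | d (g * repr a)%g (h * repr a)%g < e / 2], ball a (e / 2)).
  by split=> //; exact: nbhsx_ballx.
move=> [h b] /= [hg]; rewrite ballEmdist /= => ab.
rewrite (le_lt_trans (metric_triangle _ (quotient_translation h a) _))//.
rewrite quotient_translation_isometry (splitr e) ltrD//.
by rewrite -[mdist _ _]/(quotient_dist _ _) quotient_distE.
Qed.

Lemma quotient_translation_transitive (R : realType)
    (G : topologicalGroupType) (d : left_invariant_pseudometric R G) :
  transitive_action (@quotient_translation R G d).
Proof.
move=> a b; exists (repr b * (repr a)^-1)%g.
by rewrite -{2}(left_cosetK a) quotient_translationE mulgVK left_cosetK.
Qed.

Section OrbitPseudometric.
Variables (R : realType) (G : topologicalGroupType) (X : metricType R).
Variables (act : G -> X -> X) (x0 : X).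
Hypotheses (actc : continuous_action act) (iso : acts_by_isometries act).

(** For a transitive action by isometries, the quotient of [G] by this
    pseudometric is [X] itself, through [g |-> act g x0]. *)
Definition orbit_dist (g h : G) : R := mdist (act g x0) (act h x0).

Let orbit_dist_invariant g x y :
  orbit_dist (g * x)%g (g * y)%g = orbit_dist x y.
Proof. by rewrite /orbit_dist !actc.1.2 iso. Qed.

Let orbit_dist_continuous : continuous (fun p : G * G => orbit_dist p.1 p.2).
Proof.
apply: pseudometric_continuous => [x y|y x z|x e e0].
- exact: metric_sym.
- exact: metric_triangle.
- apply: (@metricType_numDomainType.cvgr_dist_le R X G (nbhs x) _
    (fun g => act g x0)) => //.
  by apply: (cvg_action actc); [exact: cvg_id|exact: cvg_cst].
Qed.

Definition orbit_pseudometric : left_invariant_pseudometric R G :=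
  LeftInvariantPseudometric (fun _ _ => mdist_ge0 _ _) (fun _ => mdistxx _)
    (fun _ _ => metric_sym _ _) (fun _ _ _ => metric_triangle _ _ _)
    orbit_dist_invariant orbit_dist_continuous.

Lemma finite_RDM_orbit : transitive_action act ->
  finite_RDM R (@quotient_translation R G orbit_pseudometric) ->
  finite_RDM R act.
Proof.
move=> trans.
have actE g : act (repr (left_coset orbit_pseudometric g)) x0 = act g x0.
  exact: mdist_positivity (pseudodist_repr orbit_pseudometric g).
apply: (finite_RDM_equivariant
  (p := fun a : pseudometric_quotient orbit_pseudometric => act (repr a) x0)).
- apply: unif_continuous_pseudometric_quotient => A.
  rewrite -entourage_ballE => -[e /= e0 sA]; exists e => // a b ab.
  by apply: sA; rewrite /= ballEmdist.
- move=> y; have [g gy] := trans x0 y.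
  by exists (left_coset orbit_pseudometric g); rewrite actE.
- move=> g a; rewrite -{1}(left_cosetK a) quotient_translationE actE.
  exact: actc.1.2.
Qed.

End OrbitPseudometric.

Theorem theorem5p7 (R : realType) (G : topologicalGroupType) :
  [<-> fixed_point_on_compacta G;
       RDM_property R (@left_translation G);
       forall d : left_invariant_pseudometric R G,
         RDM_property R (@quotient_translation R G d);
       forall (X : metricType R) (act : G -> X -> X),
         continuous_action act -> transitive_action act ->
         acts_by_isometries act -> RDM_property R act;
       exists D : set (left_invariant_pseudometric R G),
         [/\ forall d, D d -> bounded_pseudometric d,
             generates_topology D &
             forall d, D d -> RDM_property R (@quotient_translation R G d)]].
Proof.
tfae.
- move=> fpc; apply: finite_RDM_RDM.
    exact: left_translation_equicontinuous.
  exact: fixed_point_finite_RDM.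
- move=> /RDM_finite_RDM rdm d; apply: finite_RDM_RDM.
    exact/isometric_action_equicontinuous/quotient_translation_isometry.
  exact: finite_RDM_pseudometric_quotient.
- move=> rdm X act actc trans iso; apply: finite_RDM_RDM.
    exact: isometric_action_equicontinuous.
  (* A nonempty finite set supplies the base point of the orbit map. *)
  move=> n f bf uf e [|x0 s] e0; first by exists 1%g.
  apply: (finite_RDM_orbit (x0 := x0) (actc := actc) (iso := iso)) => //.
  exact/RDM_finite_RDM/rdm.
- move=> rdm; exists [set d | bounded_pseudometric d]; split=> //.
    exact: bounded_pseudometrics_generate.
  move=> d _; apply: rdm.
  + exact: quotient_translation_continuous.
  + exact: quotient_translation_transitive.
  + exact: quotient_translation_isometry.
- move=> [D [_ gen rdm]]; apply: (@finite_RDM_fixed_point R).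
  apply: (generating_pseudometrics_finite_RDM gen) => d Dd.
  exact/RDM_finite_RDM/rdm.
Qed.
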